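(* Let $\ell$ be a prime and $a$ a nonnegative integer. Then $$P_\ell(a;q) = \Omega_\ell(a;q)\cdot P_\ell(0;q)$$ as formal power series in $q$, where $$\Omega_\ell(a;q) := \sum_{\vec{z} \in \mathcal{Z}_\ell(a)} \prod_{k=1}^\infty q^{z_k \ell^k} \cdot \sum_{m=0}^{\lfloor z_k/\ell \rfloor}f\left(\ell^{k+1};m\right)\cdot f\left(-\ell^k; z_k - m\ell\right).$$
   Context: For a partition $\lambda$ of $n$ (written $\lambda\vdash n$), draw its Ferrers–Young diagram; the hook length $H(i,j)$ of the box $(i,j)$ is the number of boxes consisting of $(i,j)$ itself and the boxes directly to its right in row $i$ and directly below it in column $j$. The hook product is $H(\lambda)=\prod_{(i,j)} H(i,j)$. For a prime $\ell$ and nonnegative integer $a$, let $p_\ell(a;n) := \#\{\lambda\vdash n : \mathrm{ord}_\ell(H(\lambda)) = a\}$ and $P_\ell(a;q) := \sum_{n\ge 0} p_\ell(a;n)q^n$. The D'Arcais polynomials $f(r;n)$ are defined, for any number $r$, by $\prod_{m=1}^\infty (1-q^m)^r = \sum_{n=0}^\infty f(r;n)q^n$. For nonnegative integer $k$ let $[k]_\ell := (\ell^k-1)/(\ell-1)$, and let $\mathcal{Z}_\ell(a)$ be the (finite) set of sequences $(z_1,z_2,\dots)$ of nonnegative integers, only finitely many nonzero, with $\sum_{k\ge1} z_k[k]_\ell = a$. *)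

(* Defs.v *)
From HB Require Import structures.
From mathcomp Require Import all_boot all_order all_algebra.
From mathcomp Require Import finmap.
From mathcomp Require Import boolp classical_sets functions cardinality fsbigop.

Set Implicit Arguments.
Unset Strict Implicit.
Unset Printing Implicit Defensive.

Import Order.TTheory GRing.Theory Num.Theory.

Local Open Scope classical_set_scope.
Local Open Scope ring_scope.

Record fps (R : Type) := FPS { fpscoef : nat -> R }.
Arguments FPS {R} _.
Arguments fpscoef {R} _ _.

HB.instance Definition _ (R : Type) := gen_eqMixin (fps R).
HB.instance Definition _ (R : Type) := gen_choiceMixin (fps R).

Lemma fpsP (R : Type) (f g : fps R) : fpscoef f =1 fpscoef g <-> f = g.
Proof.
split=> [|-> //]; case: f g => [f] [g] /= fg.
by congr FPS; apply/funext.
Qed.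

Section FpsRing.
Variable R : comNzRingType.
Implicit Types f g h : fps R.

Definition fps0 : fps R := FPS (fun=> 0).
Definition fps1 : fps R := FPS (fun n => (n == 0%N)%:R).
Definition fps_opp f : fps R := FPS (fun n => - fpscoef f n).
Definition fps_add f g : fps R := FPS (fun n => fpscoef f n + fpscoef g n).
Definition fps_mul f g : fps R :=
  FPS (fun n => \sum_(i < n.+1) fpscoef f i * fpscoef g (n - i)%N).

Lemma fps_addA : associative fps_add.
Proof. by move=> f g h; apply/fpsP => n /=; rewrite addrA. Qed.
Lemma fps_addC : commutative fps_add.
Proof. by move=> f g; apply/fpsP => n /=; rewrite addrC. Qed.
Lemma fps_add0 : left_id fps0 fps_add.
Proof. by move=> f; apply/fpsP => n /=; rewrite add0r. Qed.
Lemma fps_addN : left_inverse fps0 fps_opp fps_add.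
Proof. by move=> f; apply/fpsP => n /=; rewrite addNr. Qed.

HB.instance Definition _ :=
  GRing.isZmodule.Build (fps R) fps_addA fps_addC fps_add0 fps_addN.

Definition fps_trunc (N : nat) f : {poly R} := \poly_(i < N) fpscoef f i.

Lemma coef_fps_trunc N f n :
  (n < N)%N -> (fps_trunc N f)`_n = fpscoef f n.
Proof. by move=> ltnN; rewrite coef_poly ltnN. Qed.

Lemma fps_mul_trunc N f g n : (n < N)%N ->
  fpscoef (fps_mul f g) n = (fps_trunc N f * fps_trunc N g)`_n.
Proof.
move=> ltnN; rewrite coefM /=; apply: eq_bigr => i _.
have lein : (i <= n)%N by rewrite -ltnS.
by rewrite !coef_fps_trunc ?(leq_ltn_trans (leq_subr _ _)) ?(leq_ltn_trans lein).
Qed.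

Lemma fps_mulC : commutative fps_mul.
Proof.
by move=> f g; apply/fpsP => n; rewrite !(@fps_mul_trunc n.+1) // mulrC.
Qed.

Lemma fps_mulA : associative fps_mul.
Proof.
move=> f g h; apply/fpsP => n.
transitivity ((fps_trunc n.+1 f * fps_trunc n.+1 g * fps_trunc n.+1 h)`_n).
  rewrite -mulrA coefM /=; apply: eq_bigr => i _.
  rewrite coef_fps_trunc // -(@fps_mul_trunc n.+1) //.
  by rewrite ltnS leq_subr.
rewrite coefM /=; apply: eq_bigr => i _.
rewrite -(@fps_mul_trunc n.+1) // coef_fps_trunc //.
by rewrite ltnS leq_subr.
Qed.

Lemma fps_mul1 : left_id fps1 fps_mul.
Proof.
move=> f; apply/fpsP => n /=.
rewrite big_ord_recl /= mul1r subn0 big1 ?addr0 // => i _.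
by rewrite mul0r.
Qed.

Lemma fps_mulDl : left_distributive fps_mul fps_add.
Proof.
move=> f g h; apply/fpsP => n /=.
by rewrite -big_split; apply: eq_bigr => i _; rewrite mulrDl.
Qed.

Lemma fps_oner_neq0 : fps1 != 0.
Proof.
apply/eqP => /fpsP /(_ 0%N) /= /eqP.
by rewrite (negPf (oner_neq0 R)).
Qed.

HB.instance Definition _ := GRing.Zmodule_isComNzRing.Build (fps R)
  fps_mulA fps_mulC fps_mul1 fps_mulDl fps_oner_neq0.

Definition fpsC (c : R) : fps R := FPS (fun n => if n == 0%N then c else 0).
Definition fpsX : fps R := FPS (fun n => (n == 1%N)%:R).

(* The infinite product of the F m, m >= 1, for families such that F m is 1
   modulo q^m; [fpscoef_infprod] shows that truncating is then harmless. *)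
Definition fps_infprod (F : nat -> fps R) : fps R :=
  FPS (fun n => fpscoef (\prod_(1 <= m < n.+1) F m) n).

Lemma fpscoef_infprod (F : nat -> fps R) :
  (forall m n, (0 < m)%N -> (n < m)%N -> fpscoef (F m) n = (n == 0%N)%:R) ->
  forall n N, (n <= N)%N ->
  fpscoef (\prod_(1 <= m < N.+1) F m) n = fpscoef (fps_infprod F) n.
Proof.
move=> F1 n N; elim: N => [|N IHN]; first by rewrite leqn0 => /eqP ->.
rewrite leq_eqVlt => /predU1P[-> //|ltnN].
rewrite big_nat_recr //= big_ord_recr /= subnn F1 // mulr1.
rewrite big1 ?add0r ?IHN // => i _.
rewrite F1 //; last by rewrite (leq_ltn_trans (leq_subr _ _)).
by rewrite subn_eq0 leqNgt ltn_ord mulr0.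
Qed.

End FpsRing.

Arguments fpsX {R}.

Section DArcais.
Variable K : numFieldType.

Definition gbinom (r : K) (j : nat) : K :=
  (\prod_(i < j) (r - i%:R)) / j`!%:R.

(* (1 - q^m)^r for m >= 1, by Newton's binomial series *)
Definition one_sub_qpow (m : nat) (r : K) : fps K :=
  FPS (fun n => if (m %| n)%N then (-1) ^+ (n %/ m) * gbinom r (n %/ m) else 0).

Definition darcais (r : K) (n : nat) : K :=
  fpscoef (fps_infprod (fun m => one_sub_qpow m r)) n.

Lemma one_sub_qpow_low (r : K) (m n : nat) : (0 < m)%N -> (n < m)%N ->
  fpscoef (one_sub_qpow m r) n = (n == 0%N)%:R.
Proof.
move=> m_gt0 ltnm /=; case: (posnP n) => [->|n_gt0].
  by rewrite dvdn0 div0n /gbinom big_ord0 divr1 mulr1.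
by rewrite gtnNdvd // (gtn_eqF n_gt0).
Qed.

End DArcais.

(* A partition is its weakly decreasing list of positive parts; boxes are
   indexed from 0. *)
Definition is_partition (n : nat) (lam : seq nat) : Prop :=
  [&& sorted geq lam, 0%N \notin lam & sumn lam == n].

Definition boxes (lam : seq nat) : seq (nat * nat) :=
  [seq (i, j) | i <- iota 0 (size lam), j <- iota 0 (nth 0%N lam i)].

Definition hook_length (lam : seq nat) (b : nat * nat) : nat :=
  count (fun c => ((c.1 == b.1) && (b.2 <= c.2)%N)
               || ((c.2 == b.2) && (b.1 <= c.1)%N)) (boxes lam).

Definition hook_product (lam : seq nat) : nat :=
  (\prod_(b <- boxes lam) hook_length lam b)%N.

Definition p_hook (l a n : nat) : nat :=
  #|` fset_set [set lam : seq nat |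
        is_partition n lam /\ logn l (hook_product lam) = a] |.

(* [fset_set] is only meaningful on finite sets. *)
Lemma finite_partitions (n : nat) : finite_set [set lam | is_partition n lam].
Proof.
pose T := {k : 'I_n.+1 & k.-tuple 'I_n.+1}.
pose g (u : T) : seq nat := map (@nat_of_ord _) (val (tagged u)).
apply: (@sub_finite_set _ _ (g @` [set: T])); last exact/finite_image/finite_finset.
move=> lam /and3P[_ lam0 /eqP lamn].
have szlam : (size lam <= n)%N.
  rewrite -lamn; elim: lam lam0 {lamn} => //= x s IHs.
  rewrite inE negb_or eq_sym -lt0n => /andP[x0 /IHs].
  by rewrite -add1n; apply: leq_add.
have lelam x : x \in lam -> (x <= n)%N.
  rewrite -lamn; elim: lam {lam0 lamn szlam} => //= y s IHs.
  rewrite inE => /predU1P[-> | /IHs xs]; first exact: leq_addr.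
  exact: leq_trans xs (leq_addl _ _).
have szt : size (map (@inord n) lam) == Ordinal (szlam : (size lam < n.+1)%N).
  by rewrite size_map.
exists (existT _ (Ordinal (szlam : (size lam < n.+1)%N)) (Tuple szt)) => //.
rewrite /g /= -map_comp -[RHS]map_id; apply/eq_in_map => x /lelam lexn /=.
by rewrite inordK.
Qed.

Definition P_hook (l a : nat) : fps rat := FPS (fun n => (p_hook l a n)%:R).

Definition qbracket (l k : nat) : nat := ((l ^ k - 1) %/ (l - 1))%N.

(* The sequence (z_1, z_2, ...) is encoded as z : nat -> nat with the unused
   entry z 0 pinned to 0. *)
Definition Zset (l a : nat) : set (nat -> nat) :=
  [set z | [/\ z 0%N = 0%N, finite_set [set k | z k <> 0%N] &
    \big[addn/0%N]_(k \in [set k | (1 <= k)%N]) (z k * qbracket l k)%N = a]].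

(* Finitely supported sum and product: Zset l a is finite, and the factor of
   index k is 1 whenever z k = 0. *)
Definition Omega (l a : nat) : fps rat :=
  \sum_(z \in Zset l a)
    \big[*%R/1]_(k \in [set k | (1 <= k)%N])
      (fpsX ^+ (z k * l ^ k)%N *
       fpsC (\sum_(0 <= m < (z k %/ l).+1)
          darcais ((l ^ k.+1)%:R : rat) m *
          darcais (- (l ^ k)%:R : rat) (z k - m * l)%N)).

(* Main.v *)
(* Read the boundary of a partition as a 0/1 word: hooks become pairs of a bead
   followed by a hole, hook lengths their distances.  Distributing the positions
   of the word over its residues mod l (the l runners of the abacus) keeps
   exactly the hooks divisible by l and divides them by l, which gives
   Littlewood's decomposition into an l-core and l quotients.  In terms of
   F(x; q), the sum of x^ord_l(H(lambda)) q^|lambda| over all partitions,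
     F(x; q) = C(q) F(x; x q^l)^l,   C(q) = F(0; q) = P_l(0; q).
   At x = 1 this reads P(q) = C(q) P(q^l)^l with P the partition generating
   function, so that C^(l^k) is a product of two D'Arcais generating functions.
   Iterating the functional equation yields
     F(x; q) = prod_(k >= 0) C(x^[k] q^(l^k))^(l^k),
   and Omega_l(a; q) P_l(0; q) is the coefficient of x^a. *)
From HB Require Import structures.
Require Import Defs.
From mathcomp Require Import all_boot all_order all_algebra.
From mathcomp Require Import finmap.
From mathcomp Require Import boolp classical_sets functions cardinality fsbigop.
From mathcomp Require Import zify ring.

Set Implicit Arguments.
Unset Strict Implicit.
Unset Printing Implicit Defensive.

Import Order.TTheory GRing.Theory Num.Theory.

Local Open Scope ring_scope.

(** * Formal power series *)


Section FpsTheory.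
Variable R : comNzRingType.
Implicit Types (f g : fps R) (c : R) (n v : nat).

Lemma fpscoefD f g n : fpscoef (f + g) n = fpscoef f n + fpscoef g n.
Proof. by []. Qed.

Lemma fpscoefN f n : fpscoef (- f) n = - fpscoef f n.
Proof. by []. Qed.

Lemma fpscoefM f g n :
  fpscoef (f * g) n = \sum_(i < n.+1) fpscoef f i * fpscoef g (n - i)%N.
Proof. by []. Qed.

Lemma fpscoef1 n : fpscoef (1 : fps R) n = (n == 0%N)%:R.
Proof. by []. Qed.

Lemma fpscoef_sum (I : Type) (r : seq I) (P : pred I) (F : I -> fps R) n :
  fpscoef (\sum_(i <- r | P i) F i) n = \sum_(i <- r | P i) fpscoef (F i) n.
Proof. exact: (big_morph (fun f => fpscoef f n)). Qed.

Lemma fpscoefXnM k f n :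
  fpscoef (fpsX ^+ k * f) n = if (k <= n)%N then fpscoef f (n - k) else 0.
Proof.
elim: k n => [|k IHk] n; first by rewrite expr0 mul1r subn0.
rewrite exprS -mulrA fpscoefM; case: n => [|n].
  by rewrite big_ord1 mul0r.
rewrite 2!big_ord_recl big1 ?addr0 => [|i _]; last exact: mul0r.
by rewrite mul0r add0r mul1r lift0 subSS subn0 IHk ltnS subSS.
Qed.

Lemma fpscoefXn k n : fpscoef (fpsX ^+ k : fps R) n = (n == k)%:R.
Proof.
rewrite -[fpsX ^+ k]mulr1 fpscoefXnM fpscoef1 subn_eq0 eqn_leq andbC.
by case: leqP.
Qed.

Lemma fpscoefCM c f n : fpscoef (fpsC c * f) n = c * fpscoef f n.
Proof.
rewrite fpscoefM big_ord_recl subn0 big1 ?addr0 // => i _.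
by rewrite mul0r.
Qed.

Lemma fpscoef_monom k c n :
  fpscoef (fpsX ^+ k * fpsC c) n = if n == k then c else 0.
Proof.
by rewrite mulrC fpscoefCM fpscoefXn; case: eqP; rewrite ?mulr1 ?mulr0.
Qed.

Lemma fpsC_is_zmod_morphism : zmod_morphism (@fpsC R).
Proof. by move=> x y; apply/fpsP => -[|n] //=; rewrite subr0. Qed.

Lemma fpsC_is_monoid_morphism : monoid_morphism (@fpsC R).
Proof.
split=> [|x y]; apply/fpsP => n; first by case: n.
by rewrite fpscoefCM; case: n => //= n; rewrite mulr0.
Qed.

HB.instance Definition _ :=
  GRing.isZmodMorphism.Build R (fps R) (@fpsC R) fpsC_is_zmod_morphism.
HB.instance Definition _ :=
  GRing.isMonoidMorphism.Build R (fps R) (@fpsC R) fpsC_is_monoid_morphism.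

(** Congruence modulo q^(D+1): the coefficient of q^D is still compared. *)
Definition eqmodX (D : nat) f g :=
  forall n, (n <= D)%N -> fpscoef f n = fpscoef g n.

Lemma eqmodX_eq f g : (forall D, eqmodX D f g) -> f = g.
Proof. by move=> fg; apply/fpsP => n; apply: fg (leqnn n). Qed.

Lemma eqmodX_sym D f g : eqmodX D f g -> eqmodX D g f.
Proof. by move=> fg n nD; rewrite fg. Qed.

Lemma eqmodX_trans D g f h : eqmodX D f g -> eqmodX D g h -> eqmodX D f h.
Proof. by move=> fg gh n nD; rewrite fg ?gh. Qed.

Lemma eqmodX_sum D (I : Type) (r : seq I) (P : pred I) (F G : I -> fps R) :
  (forall i, P i -> eqmodX D (F i) (G i)) ->
  eqmodX D (\sum_(i <- r | P i) F i) (\sum_(i <- r | P i) G i).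
Proof.
by move=> FG n nD; rewrite !fpscoef_sum; apply: eq_bigr => i /FG ->.
Qed.

Lemma eqmodXM D f1 f2 g1 g2 :
  eqmodX D f1 g1 -> eqmodX D f2 g2 -> eqmodX D (f1 * f2) (g1 * g2).
Proof.
move=> fg1 fg2 n nD; rewrite !fpscoefM; apply: eq_bigr => i _.
by rewrite fg1 ?fg2 //; have := ltn_ord i; lia.
Qed.

Lemma eqmodX_prod D (I : Type) (r : seq I) (P : pred I) (F G : I -> fps R) :
  (forall i, P i -> eqmodX D (F i) (G i)) ->
  eqmodX D (\prod_(i <- r | P i) F i) (\prod_(i <- r | P i) G i).
Proof. by move=> FG; apply: big_ind2 => // *; apply: eqmodXM. Qed.

Lemma eqmodXX D f g k : eqmodX D f g -> eqmodX D (f ^+ k) (g ^+ k).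
Proof.
move=> fg; elim: k => [|k IHk]; rewrite ?expr0 ?exprS //; exact: eqmodXM.
Qed.

Lemma eqmodXXnM D k f g : (k <= D -> eqmodX D f g)%N ->
  eqmodX D (fpsX ^+ k * f) (fpsX ^+ k * g).
Proof.
move=> fg n nD; rewrite !fpscoefXnM; case: leqP => // kn.
by rewrite fg ?(leq_trans kn) // (leq_trans (leq_subr _ _)).
Qed.

(* Substitution of [c q^v] for [q]. *)
Definition fps_subst c v f : fps R :=
  FPS (fun n => if (v %| n)%N then c ^+ (n %/ v) * fpscoef f (n %/ v) else 0).

Lemma fpscoef_subst c v f n : fpscoef (fps_subst c v f) n =
  if (v %| n)%N then c ^+ (n %/ v) * fpscoef f (n %/ v) else 0.
Proof. by []. Qed.

Lemma sum_dvdn v k (G : nat -> R) : (0 < v)%N ->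
  \sum_(i < (k * v).+1 | (v %| i)%N) G i = \sum_(j < k.+1) G (j * v)%N.
Proof.
move=> v0; rewrite -(big_mkord (fun i => v %| i)%N G) big_mkcond /=.
rewrite big_nat_recr //= dvdn_mull // [RHS]big_ord_recr /=; congr (_ + _).
rewrite big_nat_mul -(big_mkord xpredT (fun j => G (j * v)%N)).
apply: eq_bigr => j _; rewrite big_ltn ?ltn_pmul2r // dvdn_mull //.
rewrite big_nat_cond big1 => [|i /andP[/andP[lo hi] _]]; first exact: addr0.
case: ifP => // /dvdnP[i' def_i]; move: lo hi.
by rewrite def_i !ltn_pmul2r //; lia.
Qed.

(** In the Cauchy product for q^n, [i] and [n - i] can both be multiples of [v] only if [n] is one;
    then the terms with [v] dividing [i] survive, and their powers of [c] add up. *)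
Lemma fps_subst_is_monoid_morphism c v :
  (0 < v)%N -> monoid_morphism (fps_subst c v).
Proof.
move=> v0; split=> [|f g]; apply/fpsP => n.
  rewrite fpscoef_subst !fpscoef1; case: ifPn => [/dvdnP[k ->]|].
    rewrite mulnK // muln_eq0 (gtn_eqF v0) orbF.
    by case: k => [|k]; rewrite ?mulr1 ?mulr0.
  by case: n => //; rewrite dvdn0.
rewrite fpscoef_subst [RHS]fpscoefM.
under [RHS]eq_bigr => i _ do rewrite !fpscoef_subst.
case: ifPn => [/dvdnP[k ->]|vn].
  rewrite mulnK // fpscoefM mulr_sumr.
  pose T i := fpscoef (fps_subst c v f) i * fpscoef (fps_subst c v g) (k * v -
    i).
  rewrite [RHS](bigID (fun i : 'I__ => v %| i)%N) /= [X in _ + X]big1 => [|i].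
    rewrite addr0 (sum_dvdn k T v0).
    apply: eq_bigr => i _; rewrite /T /= -mulnBl !dvdn_mull // !mulnK //.
    rewrite mulrACA -exprD subnKC //; have := ltn_ord i; lia.
  by move=> /negPf ->; rewrite mul0r.
rewrite big1 // => i _; case: ifP => [vi|]; last by rewrite mul0r.
case: ifP => [vni|]; last by rewrite mulr0.
have le_in : (i <= n)%N by rewrite -ltnS.
by have := dvdn_add vi vni; rewrite subnKC // (negPf vn).
Qed.

Lemma fps_subst1 c v : (0 < v)%N -> fps_subst c v 1 = 1.
Proof. by move/(fps_subst_is_monoid_morphism c) => []. Qed.

Lemma fps_substM c v f g : (0 < v)%N ->
  fps_subst c v (f * g) = fps_subst c v f * fps_subst c v g.
Proof. by move/(fps_subst_is_monoid_morphism c) => []. Qed.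

Lemma fps_substX c v f k : (0 < v)%N ->
  fps_subst c v (f ^+ k) = fps_subst c v f ^+ k.
Proof.
move=> v0; elim: k => [|k IHk]; first by rewrite !expr0 fps_subst1.
by rewrite !exprS fps_substM // IHk.
Qed.

Lemma fps_subst_sum c v (I : Type) (r : seq I) (P : pred I) (F : I -> fps R) :
  fps_subst c v (\sum_(i <- r | P i) F i) =
  \sum_(i <- r | P i) fps_subst c v (F i).
Proof.
apply/fpsP => n; rewrite fpscoef_sum fpscoef_subst fpscoef_sum.
under [RHS]eq_bigr => i _ do rewrite fpscoef_subst.
by case: ifP => _; [exact: mulr_sumr | rewrite big1].
Qed.

Lemma fps_subst_monom c v a k : (0 < v)%N ->
  fps_subst c v (fpsX ^+ k * fpsC a) = fpsX ^+ (v * k) * fpsC (c ^+ k * a).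
Proof.
move=> v0; apply/fpsP => n; rewrite fpscoef_subst !fpscoefXnM /=.
case: ifP => [/dvdnP[j ->]|vn].
  rewrite mulnK // [(v * k)%N]mulnC leq_pmul2r // -mulnBl muln_eq0 (gtn_eqF v0)
    orbF.
  case: leqP => kj; rewrite ?mulr0 // subn_eq0; case: ifP => jk;
    rewrite ?mulr0 //.
  by congr (c ^+ _ * _); lia.
case: ifP => // vkn; case: eqP => // e; move: vn.
by rewrite (_ : n = v * k)%N ?dvdn_mulr //; lia.
Qed.

(** Putting c q^v for q turns d q^u into d c^u q^(v u). For c = x^[k], v = l^k, d = x and u = l the
    new coefficient is x^(l [k] + 1) = x^[k+1], which is how the brackets arise. *)
Lemma fps_subst_comp c v d u f : (0 < v)%N -> (0 < u)%N ->
  fps_subst c v (fps_subst d u f) = fps_subst (d * c ^+ u) (v * u) f.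
Proof.
move=> v0 u0; apply/fpsP => n; rewrite !fpscoef_subst.
case: ifPn => [/dvdnP[k ->]|]; last first.
  by case: ifP => // /(dvdn_trans (dvdn_mulr _ (dvdnn v))) ->.
rewrite mulnK // [(k * v)%N]mulnC dvdn_pmul2l // divnMl //.
case: ifP; rewrite ?mulr0 // => /dvdnP[j ->]; rewrite mulnK //.
by rewrite mulrA exprMn -exprM [(j * u)%N]mulnC [_ ^+ j * _ ^+ _]mulrC.
Qed.

Lemma eqmodX_subst D c v f g :
  eqmodX D f g -> eqmodX D (fps_subst c v f) (fps_subst c v g).
Proof.
by move=> fg n nD; rewrite !fpscoef_subst fg // (leq_trans (leq_div _ _)).
Qed.

Lemma fps_subst1n f : fps_subst 1 1 f = f.
Proof. by apply/fpsP => n; rewrite fpscoef_subst dvd1n divn1 expr1n mul1r. Qed.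

End FpsTheory.

Section FpsMap.
Variables (R S : comNzRingType) (phi : {rmorphism R -> S}).

Definition fps_map (f : fps R) : fps S := FPS (fun n => phi (fpscoef f n)).

Lemma fps_mapM f g : fps_map (f * g) = fps_map f * fps_map g.
Proof.
apply/fpsP => n /=; rewrite rmorph_sum.
by apply: eq_bigr => i _; rewrite rmorphM.
Qed.

Lemma fps_map1 : fps_map 1 = 1.
Proof. by apply/fpsP => n /=; rewrite rmorph_nat. Qed.

Lemma fps_mapX f k : fps_map (f ^+ k) = fps_map f ^+ k.
Proof.
by elim: k => [|k IHk]; rewrite ?expr0 ?fps_map1 // !exprS fps_mapM IHk.
Qed.

Lemma eqmodX_map D f g : eqmodX D f g -> eqmodX D (fps_map f) (fps_map g).
Proof. by move=> fg n nD /=; rewrite fg. Qed.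

End FpsMap.

(** * Words and hook lengths *)


(* A partition is read off a 0/1 word along its boundary, from the top row
   down: [true] is a row (a bead), [false] a column (a hole), and the boxes
   correspond to the pairs of a bead followed by a hole; the hook length of a
   box is the distance between the two. *)
Fixpoint word_parts (w : bitseq) : seq nat :=
  if w is b :: u then
    if b then count negb u :: word_parts u else word_parts u
  else [::].

(** With [f] constantly 1 this is the size of the partition; with [f] the l-adic valuation it is the
    order of the hook product. *)
Definition word_inv (f : nat -> nat) (w : bitseq) : nat :=
  (\sum_(0 <= i < size w) \sum_(0 <= j < size w)
     if [&& (i < j), nth false w i & ~~ nth false w j] then f (j - i) else 0)%N.

Lemma word_inv_cons f b u : word_inv f (b :: u) =
  ((if b then \sum_(0 <= j < size u) if nth false u j then 0 else f j.+1 else 0)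
   + word_inv f u)%N.
Proof.
rewrite /word_inv /= big_nat_recl // big_nat_recl //= add0n; congr (_ + _)%N.
  case: b => /=; last by rewrite big1.
  by apply: eq_bigr => j _; rewrite subn0; case: nth.
by apply: eq_bigr => i _; rewrite big_nat_recl //= add0n.
Qed.

Lemma word_parts_le w : {in word_parts w, forall x, x <= count negb w}%N.
Proof.
elim: w => //= -[] w IHw x /=; last by move/IHw; lia.
by rewrite inE add0n => /predU1P[-> | /IHw].
Qed.

Lemma word_parts_sorted w : sorted geq (word_parts w).
Proof.
elim: w => //= -[] w IHw //=; rewrite path_sortedE ?IHw ?andbT; last first.
  by move=> y x z /= ? ?; lia.
by apply/allP => x /word_parts_le.
Qed.

Lemma size_word_parts w : size (word_parts w) = count id w.
Proof. by elim: w => //= -[] w <-. Qed.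

Lemma sumn_word_parts w : sumn (word_parts w) = word_inv (fun=> 1%N) w.
Proof.
elim: w => [|b w IHw]; first by rewrite /word_inv big_geq.
rewrite word_inv_cons -IHw; case: b => //=; congr (_ + _)%N.
elim: w {IHw} => [|b w IHw]; first by rewrite big_geq.
by rewrite /= big_nat_recl // IHw; case: b.
Qed.

(** Both words have the same number of holes. If their first letters differ, the word starting with
    a bead has a part equal to that number, while the parts of the other are smaller because its
    leading hole precedes every bead. *)
Lemma word_parts_inj w1 w2 : size w1 = size w2 -> count id w1 = count id w2 ->
  word_parts w1 = word_parts w2 -> w1 = w2.
Proof.
elim: w1 w2 => [|b1 w1 IHw] [|b2 w2] //= [sz].
have cc (w : bitseq) : (count id w + count negb w = size w)%N.
  by rewrite -(count_predC id).
have := cc w1; have := cc w2; case: b1 b2 => [] [] /=; rewrite ?add0n.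
- by move=> _ _ [c12] [_ p12]; rewrite (IHw w2).
- move=> c2 c1 c12 p12; have /word_parts_le : count negb w1 \in word_parts w2.
    by rewrite -p12 mem_head.
  by lia.
- move=> c2 c1 c12 p12; have /word_parts_le : count negb w2 \in word_parts w1.
    by rewrite p12 mem_head.
  by lia.
- by move=> _ _ c12 p12; rewrite (IHw w2).
Qed.

(** Greedy walk along the boundary with [h] columns left: a bead if the largest part equals [h],
    otherwise a hole, which lowers [h] by one. *)
Lemma word_parts_surj h s : sorted geq s -> all (leq^~ h) s ->
  exists2 w, (count id w = size s /\ count negb w = h) & word_parts w = s.
Proof.
have [k] := ubnP (h + size s)%N; elim: k h s => // k IHk h s lt_k s_sorted s_le.
case: s => [|x s] in lt_k s_sorted s_le *.
  exists (nseq h false); last by elim: h {lt_k s_le}.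
  by rewrite !count_nseq /= mul0n mul1n.
have ss : sorted geq s by exact: path_sorted s_sorted.
have sx : all (leq^~ x) s by apply: order_path_min s_sorted => ? ? ? /= ? ?;
  lia.
case/andP: s_le => x_h s_le; move: x_h; rewrite leq_eqVlt =>
  /predU1P[eq_x|lt_x].
  have [|w [cw hw] pw] := IHk h s _ ss s_le; first by move: lt_k => /=; lia.
  by exists (true :: w); rewrite /= ?cw ?hw ?pw ?eq_x.
have [| |w [cw hw] pw] := IHk h.-1 (x :: s) _ s_sorted.
- by move: lt_k => /=; lia.
- by rewrite /= (_ : x <= h.-1)%N; [apply: sub_all sx => y /=; lia | lia].
by exists (false :: w); rewrite //= cw hw add0n; split=> //; lia.
Qed.


(** * Hook lengths row by row *)

Lemma boxes_cons x s : boxes (x :: s) =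
  [seq (0%N, j) | j <- iota 0 x] ++ [seq (b.1.+1, b.2) | b <- boxes s].
Proof.
rewrite /boxes /= (iotaDl 1 0) -map_comp map_flatten -map_comp.
congr (_ ++ flatten _); apply: eq_map => i /=.
by rewrite -[in RHS]map_comp.
Qed.

Lemma boxes_rcons0 s : boxes (rcons s 0%N) = boxes s.
Proof.
elim: s => [|x s IHs] //=.
by rewrite !boxes_cons IHs.
Qed.

(** Arms go right and legs go down, so a new top row changes no hook below it. *)
Lemma hook_length_cons_S x s b :
  hook_length (x :: s) (b.1.+1, b.2) = hook_length s b.
Proof.
rewrite /hook_length boxes_cons count_cat !count_map /=.
rewrite (eq_count (a2 := pred0)) ?count_pred0 => [|j] /=; last by rewrite andbF.
rewrite add0n; exact: eq_count.
Qed.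

Lemma count_boxes_col s j :
  count (fun c => c.2 == j) (boxes s) = count (fun y => j < y)%N s.
Proof.
elim: s => //= x s IHs; rewrite boxes_cons count_cat !count_map -IHs.
congr (_ + _)%N; rewrite (eq_count (a2 := pred1 j)) //.
by rewrite count_uniq_mem ?iota_uniq // mem_iota add0n.
Qed.

Lemma hook_length_cons_0 x s j : (j < x)%N ->
  hook_length (x :: s) (0, j)%N = (x - j + count (fun y => j < y)%N s)%N.
Proof.
move=> j_x; rewrite /hook_length boxes_cons count_cat !count_map /=.
congr (_ + _)%N.
  rewrite (eq_count (a2 := leq j)) => [|i]; last first.
    by rewrite /= andbT; case: ltngtP.
  rewrite -{1}(subnKC (ltnW j_x)) iotaD count_cat add0n -[RHS]add0n.
  congr (_ + _)%N.
    apply/eqP; rewrite eqn0Ngt -has_count; apply/hasPn => i.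
    by rewrite mem_iota -ltnNge => /andP[].
  rewrite -[RHS](size_iota j); apply/eqP; rewrite -all_count.
  by apply/allP => i; rewrite mem_iota => /andP[].
by rewrite -count_boxes_col; apply: eq_count => i /=; rewrite andbT.
Qed.

Lemma hook_length_gt0 s b : b \in boxes s -> (0 < hook_length s b)%N.
Proof.
by move=> sb; rewrite -has_count; apply/hasP; exists b => //=;
  rewrite eqxx leqnn.
Qed.

Lemma hook_product_cons x s : hook_product (x :: s) =
  ((\prod_(0 <= j < x) (x - j + count (fun y => j < y) s)) * hook_product s)%N.
Proof.
rewrite /hook_product {1}boxes_cons big_cat !big_map /=; congr (_ * _)%N.
  rewrite /index_iota subn0; apply: eq_big_seq => j; rewrite mem_iota => jx.
  by rewrite hook_length_cons_0.
by apply: eq_bigr => b _; rewrite hook_length_cons_S.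
Qed.

Lemma hook_product_gt0 s : (0 < hook_product s)%N.
Proof.
by rewrite /hook_product big_seq; apply: prodn_cond_gt0 => b /hook_length_gt0.
Qed.

(* The hooks of the first row of the diagram of the word [true :: w]. *)
Lemma first_row_hooks (g : nat -> nat) w :
  (\sum_(0 <= j < count negb w)
     g (count negb w - j + count (fun y => j < y) (word_parts w)) =
   \sum_(0 <= j < size w) if nth false w j then 0 else g j.+1)%N.
Proof.
elim: w g => [|[] w IHw] g; first by rewrite !big_geq.
  (* A bead in front lengthens every leg of the first row by one and moves every later hole one step
     further away. *)
  rewrite [RHS]big_nat_recl //= add0n -(IHw (fun h => g h.+1)) add0n.
  apply: eq_big_nat => j /andP[_ jw]; by rewrite jw addnCA.
(* A hole in front is the last column of the first row. Its box has hook length 1, as no lower row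
   reaches it; the other arms grow by one. *)
rewrite [RHS]big_nat_recl //= -(IHw (fun h => g h.+1)) add1n big_nat_recr //=
  addnC.
congr (_ + _)%N.
  congr g; rewrite subSnn add1n; congr _.+1; apply/eqP;
    rewrite eqn0Ngt -has_count.
  by apply/hasPn => x /word_parts_le; rewrite -leqNgt.
by apply: eq_big_nat => j /andP[_ jw]; rewrite subSn ?(ltnW jw).
Qed.

Lemma logn_prod l (I : eqType) (r : seq I) (F : I -> nat) :
  (forall i, i \in r -> 0 < F i)%N ->
  logn l (\prod_(i <- r) F i) = (\sum_(i <- r) logn l (F i))%N.
Proof.
elim: r => [|i r IHr] F0; first by rewrite !big_nil logn1.
rewrite !big_cons lognM ?IHr // => [j rj||]; first by rewrite F0 // inE rj orbT.
  by rewrite F0 ?mem_head.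
by rewrite big_seq prodn_cond_gt0 // => j rj; rewrite F0 // inE rj orbT.
Qed.

Lemma logn_hook_product_word l w :
  logn l (hook_product (word_parts w)) = word_inv (logn l) w.
Proof.
elim: w => [|b w IHw]; first by rewrite /word_inv big_geq // /hook_product
  big_nil logn1.
rewrite word_inv_cons -IHw; case: b => //=.
rewrite hook_product_cons lognM ?hook_product_gt0 // -?first_row_hooks.
  congr (_ + _)%N; rewrite logn_prod // => j; rewrite mem_index_iota; lia.
by rewrite big_seq prodn_cond_gt0 // => j; rewrite mem_index_iota; lia.
Qed.

Lemma sorted_geq_nseq0 s : sorted geq s ->
  s = filter (ltn 0) s ++ nseq (size s - size (filter (ltn 0) s)) 0%N.
Proof.
elim: s => //= x s IHs; rewrite path_sortedE => [|y z t /= ? ?]; last by lia.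
case/andP=> sx ss; case: posnP => [x0|x0] /=; last by rewrite -IHs.
rewrite (_ : filter _ s = [::]) /=.
  by rewrite x0 /=; congr (_ :: _); apply/all_pred1P;
    apply: sub_all sx => y /=; rewrite x0 leqn0.
rewrite (eq_in_filter (a2 := pred0)) ?filter_pred0 // => y ys.
by have /= := allP sx _ ys; rewrite x0; case: y {ys}.
Qed.

Lemma hook_product_nseq0 s k : hook_product (s ++ nseq k 0%N) = hook_product s.
Proof.
have boxes_s : boxes (s ++ nseq k 0%N) = boxes s.
  elim: k s => [|k IHk] s; first by rewrite cats0.
  by rewrite -cat_rcons IHk boxes_rcons0.
by rewrite /hook_product /hook_length boxes_s.
Qed.

(** * The abacus *)


Section Abacus.
Variables (l m : nat).
Hypothesis l_gt0 : (0 < l)%N.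
Implicit Types (w : bitseq) (F : nat -> nat).

Definition runner w r : bitseq := mkseq (fun y => nth false w (y * l + r)) m.

Lemma size_runner w r : size (runner w r) = m.
Proof. exact: size_mkseq. Qed.

Lemma nth_runner w r y : (y < m)%N ->
  nth false (runner w r) y = nth false w (y * l + r).
Proof. exact: nth_mkseq. Qed.

Lemma sum_runners F :
  (\sum_(0 <= i < m * l) F i = \sum_(r < l) \sum_(0 <= y < m) F (y * l + r))%N.
Proof.
rewrite big_nat_mul exchange_big /=; apply: eq_bigr => y _.
rewrite -{1}[(y * l)%N]add0n big_addn mulSn addnK big_mkord.
by apply: eq_bigr => r _; rewrite addnC.
Qed.

Lemma count_sum w :
  count id w = (\sum_(0 <= i < size w) nth false w i)%N.
Proof. by rewrite -sum1_count big_mkcond (big_nth false);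
  apply: eq_bigr => i _; case: nth. Qed.

Lemma count_runners w : size w = (m * l)%N ->
  count id w = (\sum_(r < l) count id (runner w r))%N.
Proof.
move=> sz; rewrite count_sum sz sum_runners; apply: eq_bigr => r _.
by rewrite count_sum size_runner; apply: eq_big_nat => y /= ?;
  rewrite nth_runner.
Qed.

(** Positions on different runners have a distance prime to [l]. On the same runner the distance is
    [l] times the one along the runner, so its valuation is one more. *)
Lemma logn_inv_runners w : prime l -> size w = (m * l)%N ->
  word_inv (logn l) w = (\sum_(r < l)
    (word_inv (fun=> 1) (runner w r) + word_inv (logn l) (runner w r)))%N.
Proof.
move=> l_prime sz; rewrite {1}/word_inv sz sum_runners; apply: eq_bigr => r _.
rewrite /word_inv size_runner -big_split; apply: eq_big_nat => y /= ym.
rewrite -big_split /= sum_runners (bigD1 r) //= [X in (_ + X)%N]big1 => [|r'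
  r'r].
  rewrite addn0; apply: eq_big_nat => y' /= y'm; rewrite !nth_runner //.
  rewrite ltn_add2r ltn_pmul2r //; case: ifP => // /and3P[lt_yy' _ _].
  by rewrite subnDr -mulnBl lognM ?subn_gt0 // (logn_prime l l_prime) eqxx
    addnC.
rewrite big1 // => y' _; case: ifP => // /and3P[lt_ _ _].
apply: logn_coprime; rewrite prime_coprime // -eqn_mod_dvd 1?ltnW //.
rewrite !modnMDl !modn_small //; apply: contra r'r => /eqP e; exact/eqP/val_inj.
Qed.

(** A bead at position [i] is followed by [size w - i.+1] letters, all holes except for the later
    beads; summed over the beads, the later beads are the pairs of beads. *)
Lemma word_inv1_sum w :
  (word_inv (fun=> 1) w + 'C(count id w, 2) +
   \sum_(0 <= i < size w) nth false w i * i.+1 = count id w * size w)%N.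
Proof.
elim: w => [|b w IHw]; first by rewrite /word_inv !big_geq.
rewrite word_inv_cons -[size (b :: w)]/(size w).+1 big_nat_recl //.
have shift : (\sum_(0 <= i < size w) nth false (b :: w) i.+1 * i.+2 =
    count id w + \sum_(0 <= i < size w) nth false w i * i.+1)%N.
  by rewrite count_sum -big_split; apply: eq_bigr => i _; rewrite mulnS.
rewrite shift -[count id (b :: w)]/(b + count id w)%N.
have holes : (\sum_(0 <= j < size w) (if nth false w j then 0 else 1) =
    size w - count id w)%N.
  rewrite -[in RHS](count_predC id w) addKn -sum1_count (big_nth false).
  by rewrite [RHS]big_mkcond; apply: eq_bigr => i _ /=; case: nth.
have := count_size id w; clear shift; case: b => /=; rewrite ?add0n;
  last by lia.
rewrite holes binS bin1; lia.
Qed.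

(* The size of the [l]-core with [nu r] beads on runner [r]. *)
Definition core_size (nu : 'I_l -> nat) : nat :=
  (\sum_(r < l) (l * 'C(nu r, 2) + (l.-1 - r) * nu r) -
   'C(\sum_(r < l) nu r, 2))%N.

(** [word_inv1_sum] for [w] is compared with [l] times its instances for the runners; only the sums
    of bead positions have to be matched. *)
Lemma inv_runners w : size w = (m * l)%N ->
  (word_inv (fun=> 1) w + 'C(count id w, 2) =
   l * (\sum_(r < l) word_inv (fun=> 1) (runner w r)) +
   \sum_(r < l) (l * 'C(count id (runner w r), 2) +
                 (l.-1 - r) * count id (runner w r)))%N.
Proof.
move=> sz; have := word_inv1_sum w; rewrite sz sum_runners => inv_w.
(* Here (y l + r + 1) + (l - 1 - r) = l (y + 1). *)
have runner_sum (r : 'I_l) : (\sum_(0 <= y < m) nth false w (y * l + r) *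
     (y * l + r).+1 +
   (l.-1 - r) * count id (runner w r) =
   l * \sum_(0 <= y < m) nth false (runner w r) y * y.+1)%N.
  rewrite count_sum size_runner !big_distrr -big_split /=.
  apply: eq_big_nat => y /= ym; rewrite nth_runner //; have := ltn_ord r.
  by case: nth => /=; nia.
have runner_inv : (l * (\sum_(r < l) word_inv (fun=> 1) (runner w r)) +
    \sum_(r < l) l * 'C(count id (runner w r), 2) +
    \sum_(r < l) l * \sum_(0 <= y < m) nth false (runner w r) y * y.+1 =
    count id w * (m * l))%N.
  rewrite big_distrr -!big_split count_runners // big_distrl /=.
  apply: eq_bigr => r _; rewrite -!mulnDr -[in X in (_ + X)%N](size_runner w r).
  by rewrite word_inv1_sum size_runner mulnC mulnA.
have sum_runner :
    (\sum_(r < l) \sum_(0 <= y < m) nth false w (y * l + r) * (y * l + r).+1 +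
     \sum_(r < l) (l.-1 - r) * count id (runner w r) =
     \sum_(r < l) l * \sum_(0 <= y < m) nth false (runner w r) y * y.+1)%N.
  by rewrite -big_split; apply: eq_bigr => r _; exact: runner_sum.
rewrite big_split /=; apply: (addIn (etrans inv_w _)).
rewrite -runner_inv -sum_runner -!addnA; congr (_ + (_ + _))%N; exact: addnC.
Qed.

(** With c = N - h the claim becomes |c| <= l c^2 + (2 s + 1 - l) c, true for every integer c
    because 0 <= s <= l - 1. The term linear in c is kept apart since it cancels in the sum over the
    runners. *)
Lemma core_term (N h s : nat) : (s < l)%N ->
  (`|N%:Z - h%:Z| + l%:Z * h%:Z * (h%:Z - 1) + 2 * s%:Z * h%:Z
     + (2 * l%:Z * h%:Z - 1) * (N%:Z - h%:Z)
   <= 2 * (l * 'C(N, 2) + s * N)%N%:Z).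
Proof.
have binE : 2 * ('C(N, 2)%:Z) = N%:Z * (N%:Z - 1).
  elim: (N) => // n IHn; rewrite binS bin1 PoszD mulrDr IHn; lia.
move=> sl; have -> : 2 * (l * 'C(N, 2) + s * N)%N%:Z =
    l%:Z * (N%:Z * (N%:Z - 1)) + 2 * s%:Z * N%:Z by rewrite -binE; lia.
set c : int := N%:Z - h%:Z; have -> : N%:Z = c + h%:Z by rewrite /c; ring.
set L := l%:Z; set S := s%:Z; set H := h%:Z.
have sl' : 0 <= S <= L - 1 by rewrite /S /L; lia.
suff : `|c| <= L * c ^+ 2 + (2 * S + 1 - L) * c.
  rewrite -subr_ge0 => c_le; rewrite -subr_ge0; apply: le_trans c_le _.
  by rewrite le_eqVlt; apply/orP; left; apply/eqP; ring.
have [c0|c0|->] := ltgtP c 0; last by rewrite normr0 !mulr0 ?expr0n ?mulr0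
  addr0.
  rewrite ltr0_norm //; nia.
rewrite gtr0_norm //; nia.
Qed.

(** Sum of [core_term] with s = l - 1 - r: the deviations from [h] add up to 0, and the constants to
    l h (l h - 1). In particular the subtraction in [core_size] is not truncated. *)
Lemma core_size_bound h (nu : 'I_l -> nat) : (\sum_(r < l) nu r = l * h)%N ->
  (\sum_(r < l) `|nu r - h|%N + 2 * 'C(\sum_(r < l) nu r, 2) <=
   2 * \sum_(r < l) (l * 'C(nu r, 2) + (l.-1 - r) * nu r))%N.
Proof.
move=> sum_nu.
have binE n : 2 * ('C(n, 2)%:Z) = n%:Z * (n%:Z - 1).
  by elim: n => // n IHn; rewrite binS bin1 PoszD mulrDr IHn; lia.
have sumZ (F : 'I_l -> nat) : (\sum_(r < l) F r)%N%:Z = \sum_(r < l) (F r)%:Z.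
  exact: (big_morph Posz PoszD).
rewrite -lez_nat PoszD !PoszM -[Posz 2]/(2 : int) binE sum_nu -sum_nu !sumZ
  mulr_sumr.
have nu0 : \sum_(r < l) ((nu r)%:Z - h%:Z) = 0.
  by rewrite sumrB -sumZ sum_nu sumr_const card_ord -mulr_natr; lia.
have sum_s : 2 * \sum_(r < l) (l.-1 - r)%N%:Z = l%:Z * (l%:Z - 1).
  rewrite -sumZ (reindex_inj rev_ord_inj) /= -binE -bin2_sum big_mkord.
  by congr (2 * Posz _); apply: eq_bigr => r _; have := ltn_ord r; lia.
apply: (@le_trans _ _ (\sum_(r < l) (`|(nu r)%:Z - h%:Z|
    + l%:Z * h%:Z * (h%:Z - 1) + 2 * (l.-1 - r)%N%:Z * h%:Z
    + (2 * l%:Z * h%:Z - 1) * ((nu r)%:Z - h%:Z)))); last first.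
  by apply: ler_sum => r _; apply: core_term; have := ltn_ord r; lia.
rewrite !big_split /= -!mulr_sumr nu0 mulr0 addr0.
have nuZ : \sum_(r < l) (nu r)%:Z = l%:Z * h%:Z by rewrite -sumZ sum_nu PoszM.
rewrite nuZ sumr_const card_ord -mulr_suml -mulr_sumr sum_s -addrA lerD2l.
by rewrite -mulr_natr natz; lia.
Qed.

(** Littlewood's size identity. The bead count is a multiple of [l] so that [core_size_bound] makes
    the subtraction in [core_size] exact. *)
Lemma word_inv1_runners w h : size w = (m * l)%N -> count id w = (l * h)%N ->
  word_inv (fun=> 1%N) w =
  (l * (\sum_(r < l) word_inv (fun=> 1%N) (runner w r)) +
   core_size (fun r => count id (runner w r)))%N.
Proof.
move=> sz cw; rewrite count_runners // in cw; have /= := core_size_bound cw.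
have /= := inv_runners sz; rewrite count_runners // /core_size.
set A := (\sum_(r < l) (_ + _))%N; set B := 'C(_, _); lia.
Qed.

(** A small core forces nearly balanced runners, so modulo a power of q every contributing runner
    has many beads and many holes. *)
Lemma core_size_range h (nu : 'I_l -> nat) r : (\sum_(r < l) nu r = l * h)%N ->
  (nu r <= h + 2 * core_size nu /\ h <= nu r + 2 * core_size nu)%N.
Proof.
move=> /core_size_bound bound.
have : (\sum_(r < l) `|nu r - h|%N <= 2 * core_size nu)%N.
  rewrite /core_size mulnBr leq_subRL; first by rewrite addnC.
  exact: leq_trans (leq_addl _ _) bound.
by rewrite (bigD1 r) //=; move: (core_size nu); lia.
Qed.

End Abacus.

(** * Generating functions of words *)


(** A partition of [n] has at most [n] parts, each at most [n], so [N] beads and [m - N] holes have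
    room for it. The bijection sends a word to its nonzero parts. *)
Lemma p_hook_words l a n N m : (n <= N)%N -> (n + N <= m)%N ->
  p_hook l a n =
  #|[set t : m.-tuple bool | [&& count id t == N, word_inv (fun=> 1%N) t == n &
                                 word_inv (logn l) t == a]]|.
Proof.
move=> n_N nN_m; set A := [set t : m.-tuple bool | _].
pose g (t : m.-tuple bool) := filter (ltn 0) (word_parts t).
have partsE (t : m.-tuple bool) :
    word_parts t = g t ++ nseq (count id t - size (g t)) 0%N.
  by rewrite {1}[LHS]sorted_geq_nseq0 ?word_parts_sorted // size_word_parts.
have g_inj : {in A &, injective g}.
  move=> t1 t2; rewrite !inE => /and3P[/eqP c1 _ _] /and3P[/eqP c2 _ _] g12.
  apply/val_inj/word_parts_inj; rewrite ?size_tuple ?c1 ?c2 //.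
  by rewrite !partsE g12 c1 c2.
have g_hook t : logn l (hook_product (g t)) = word_inv (logn l) t.
  by rewrite -logn_hook_product_word partsE hook_product_nseq0.
have g_sum t : sumn (g t) = word_inv (fun=> 1%N) t.
  by rewrite -sumn_word_parts partsE sumn_cat sumn_nseq mul0n addn0.
(* [p_hook] counts through [fset_set], so the injective image of [A] is first made a finite set of
   lists. *)
have [X memX <-] : exists2 X : {fset seq nat},
    X =i [seq g t | t <- enum A] & #|` X| = #|A|.
  exists (seq_fset imfset_key [seq g t | t <- enum A]); first exact: seq_fsetE.
  rewrite size_seq_fset undup_id ?size_map -?cardE //.
  by rewrite map_inj_in_uniq ?enum_uniq // => t1 t2; rewrite !mem_enum;
    apply: g_inj.
rewrite /p_hook; congr #|` _|; rewrite -[RHS]set_fsetK; congr fset_set.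
apply/seteqP; split=> lam /=; last first.
  rewrite memX => /mapP[t]; rewrite mem_enum inE => /and3P[_ /eqP tn /eqP ta]
    ->.
  rewrite g_hook; split=> //; apply/and3P; split; last by rewrite g_sum tn.
    by apply: sorted_filter (word_parts_sorted t) => ? ? ? /= ? ?; lia.
  by rewrite mem_filter.
move=> [/and3P[lam_sorted lam0 /eqP lam_n] lam_a].
have lam_le x : x \in lam -> (x <= n)%N.
  by rewrite -lam_n => /perm_to_rem /perm_sumn -> /=; apply: leq_addr.
have size_lam : (size lam <= n)%N.
  rewrite -lam_n -sum1_size sumnE big_seq [X in (_ <= X)%N]big_seq.
  by apply: leq_sum => x xl; rewrite lt0n; apply: contraNneq lam0 => <-.
(* Zero parts pad [lam] to [N] rows, hence to [N] beads. *)
pose s := lam ++ nseq (N - size lam) 0%N.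
have s_sorted : sorted geq s.
  rewrite /s; case: (lam) lam_sorted => [|x lam'] /=.
    by case: (N - 0)%N => //= k _; elim: k.
  by move=> p; rewrite cat_path p /=; elim: (_ - _)%N (last _ _) => //= k ->.
have s_le : all (leq^~ (m - N)%N) s.
  rewrite all_cat all_nseq leq0n orbT andbT; apply/allP => x /lam_le; lia.
have [w [cw hw] pw] := word_parts_surj s_sorted s_le.
have size_w : size w == m.
  rewrite -(count_predC id w) cw hw size_cat size_nseq; apply/eqP.
  by rewrite (subnKC (leq_trans size_lam n_N)); lia.
pose t : m.-tuple bool := Tuple size_w.
have gt : g t = lam.
  rewrite /g /= pw filter_cat (all_filterP _); last first.
    by apply/allP => x xl; rewrite /= lt0n; apply: contraNneq lam0 => <-.
  by rewrite (_ : filter _ _ = [::]) ?cats0 //; elim: (_ - _)%N.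
rewrite memX; apply/mapP; exists t; rewrite ?gt // mem_enum inE -g_hook -g_sum
  gt lam_n lam_a.
by rewrite !eqxx !andbT /= cw size_cat size_nseq (subnKC (leq_trans size_lam
  n_N)).
Qed.

Section WordGF.
Variables (R : comNzRingType) (x : R) (l : nat).

(** The variable x is a ring element: 'X gives the two-variable series, 0 the cores and 1 all
    partitions. *)
Definition word_gf (m N : nat) : fps R :=
  \sum_(t : m.-tuple bool | count id t == N)
     fpsX ^+ word_inv (fun=> 1%N) t * fpsC (x ^+ word_inv (logn l) t).

Lemma fpscoef_word_gf m N n : fpscoef (word_gf m N) n =
  \sum_(t : m.-tuple bool | (count id t == N) && (word_inv (fun=> 1%N) t == n))
    x ^+ word_inv (logn l) t.
Proof.
rewrite fpscoef_sum [LHS]big_mkcond [RHS]big_mkcond; apply: eq_bigr => t _.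
rewrite mulrC fpscoefCM fpscoefXn [n == _]eq_sym.
by case: (count id t == N) => //=; case: eqP; rewrite ?mulr1 ?mulr0.
Qed.

(* [n] beads followed by [n] holes accommodate every partition of [n]. *)
Definition hook_gf : fps R := FPS (fun n => fpscoef (word_gf (n + n) n) n).

End WordGF.

Lemma map_word_gf (R S : comNzRingType) (phi : {rmorphism R -> S}) x l m N :
  fps_map phi (word_gf x l m N) = word_gf (phi x) l m N.
Proof.
apply/fpsP => n /=; rewrite !fpscoef_word_gf rmorph_sum.
by apply: eq_bigr => t _; rewrite rmorphXn.
Qed.

Lemma map_hook_gf (R S : comNzRingType) (phi : {rmorphism R -> S}) x l :
  fps_map phi (hook_gf x l) = hook_gf (phi x) l.
Proof. by apply/fpsP => n /=; rewrite -map_word_gf. Qed.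

Lemma coef_word_gfX (R : comNzRingType) l m N n a : (n <= N)%N -> (n + N <=
  m)%N ->
  (fpscoef (word_gf ('X : {poly R}) l m N) n)`_a = (p_hook l a n)%:R.
Proof.
move=> nN nNm; rewrite (p_hook_words l a nN nNm) fpscoef_word_gf coef_sum.
under eq_bigr => t _ do rewrite coefXn.
rewrite -sum1_card natr_sum [LHS]big_mkcond [RHS]big_mkcond.
apply: eq_bigr => t _; rewrite inE [a == _]eq_sym.
by case: (count id t == N); case: (_ == n); case: (_ == a).
Qed.

Lemma coef_hook_gfX (R : comNzRingType) l n a :
  (fpscoef (hook_gf ('X : {poly R}) l) n)`_a = (p_hook l a n)%:R.
Proof. exact: coef_word_gfX. Qed.

(** In the universal case 'X the low coefficients count partitions, whatever [m] and [N]; evaluation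
    at [x] transfers this. *)
Lemma word_gf_hook_gf (R : comNzRingType) (x : R) l D m N :
  (D <= N)%N -> (D + N <= m)%N -> eqmodX D (word_gf x l m N) (hook_gf x l).
Proof.
move=> DN DNm; have phiX : horner_eval x 'X = x by rewrite /horner_eval hornerX.
rewrite -[in word_gf _]phiX -[in hook_gf _]phiX -map_word_gf -map_hook_gf.
apply: eqmodX_map => n nD; apply/polyP => a.
by rewrite coef_word_gfX ?coef_hook_gfX //; lia.
Qed.

Section FunctionalEquation.
Variables (R : comNzRingType) (x : R) (l m : nat).
Hypothesis l_prime : prime l.
Let l_gt0 : (0 < l)%N := prime_gt0 l_prime.

Definition of_runners (g : {ffun 'I_l -> m.-tuple bool}) : (m * l).-tuple bool
  :=
  [tuple nth false (g (Ordinal (ltn_pmod i l_gt0))) (i %/ l) | i < m * l].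

Lemma size_runner_tuple w r : size (runner l m w r) == m.
Proof. by rewrite size_runner. Qed.

Definition to_runners (t : (m * l).-tuple bool) : {ffun 'I_l -> m.-tuple bool}
  :=
  [ffun r : 'I_l => Tuple (size_runner_tuple t r)].

Lemma nth_of_runners g i : (i < m * l)%N ->
  nth false (of_runners g) i = nth false (g (Ordinal (ltn_pmod i l_gt0))) (i %/
    l).
Proof.
move=> i_lt; rewrite -[i]/(val (Ordinal i_lt)) -tnth_nth tnth_mktuple.
by [].
Qed.

Lemma runner_of_runners g (r : 'I_l) : runner l m (of_runners g) r = g r.
Proof.
apply: (@eq_from_nth _ false); rewrite size_runner ?size_tuple // => y ym.
have r_l := ltn_ord r.
rewrite nth_runner // nth_of_runners; last nia.
rewrite divnMDl // divn_small // addn0; congr (nth _ (g _) _).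
by apply/val_inj; rewrite /= modnMDl modn_small.
Qed.

Lemma of_runnersK : cancel of_runners to_runners.
Proof.
by move=> g; apply/ffunP => r; apply/val_inj;
  rewrite ffunE /= runner_of_runners.
Qed.

Lemma to_runnersK : cancel to_runners of_runners.
Proof.
move=> t; apply/val_inj/(@eq_from_nth _ false);
  rewrite !size_tuple // => i i_lt.
rewrite nth_of_runners // ffunE /= nth_runner ?ltn_divLR // -divn_eq.
by [].
Qed.

(** Interleaving runners is a bijection. An inversion on a runner contributes [l] to the size and
    one extra to the order, that is x q^l, whence the substitution; the rest of the size depends
    only on the bead counts [nu]. *)
Lemma word_gf_runners h : word_gf x l (m * l) (l * h) =
  \sum_(nu : {ffun 'I_l -> 'I_m.+1} | (\sum_r nu r == l * h)%N)
    fpsX ^+ core_size (fun r : 'I_l => nu r : nat) * \prod_(r < l) fps_subst x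
      l (word_gf x l m (nu r)).
Proof.
rewrite /word_gf (reindex of_runners); last first.
  by exists to_runners => g _; rewrite ?of_runnersK ?to_runnersK.
have count_lt (t : m.-tuple bool) : (count id t < m.+1)%N.
  by rewrite ltnS -{2}(size_tuple t) count_size.
pose nu_of (g : {ffun 'I_l -> m.-tuple bool}) : {ffun 'I_l -> 'I_m.+1} :=
  [ffun r => Ordinal (count_lt (g r))].
have sum_nu g : count id (of_runners g) = (\sum_r nu_of g r)%N.
  rewrite (@count_runners l m) ?size_tuple //.
  by apply: eq_bigr => r _; rewrite runner_of_runners ffunE.
rewrite (partition_big nu_of
  (fun nu : {ffun 'I_l -> 'I_m.+1} => (\sum_r nu r == l * h)%N)) => [|g];
    last first.
  by rewrite sum_nu.
apply: eq_bigr => nu /eqP nu_h.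
under [X in _ = _ * X]eq_bigr => r _ do rewrite fps_subst_sum.
(* The product of sums over single runners becomes a sum over families of runners with bead counts
   [nu]. *)
rewrite bigA_distr_big_dep big_distrr /=.
have fam g : (g \in family (fun (r : 'I_l) (t : m.-tuple bool) =>
    count id t == nu r)) = (nu_of g == nu).
  apply/familyP/eqP => [g_nu | <- r]; last by rewrite unfold_in ffunE.
  by apply/ffunP => r; apply/val_inj; rewrite ffunE /=; apply/eqP/g_nu.
rewrite (eq_bigl (fun g => nu_of g == nu)) => [|g]; last first.
  rewrite sum_nu; case: (nu_of g =P nu) => [->|]; rewrite ?andbF ?andbT //.
  by rewrite nu_h eqxx.
rewrite [RHS](eq_bigl _ _ fam).
apply: eq_bigr => g /eqP g_nu.
have cg : count id (of_runners g) = (l * h)%N by rewrite sum_nu g_nu.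
have sz : size (of_runners g) = (m * l)%N by rewrite size_tuple.
rewrite (word_inv1_runners l_gt0 sz cg) (logn_inv_runners l_gt0 l_prime sz).
have -> : core_size (fun r : 'I_l => count id (runner l m (of_runners g) r)) =
    core_size (fun r : 'I_l => nu r : nat).
  rewrite /core_size -g_nu; congr (_ - 'C(_, 2))%N.
    by apply: eq_bigr => r _; rewrite runner_of_runners ffunE.
  by apply: eq_bigr => r _; rewrite runner_of_runners ffunE.
rewrite addnC exprD -mulrA; congr (_ * _).
under [X in _ = X]eq_bigr => r _ do rewrite fps_subst_monom // -exprD.
rewrite [RHS]big_split /= big_distrr /= !prodrXr -rmorph_prod prodrXr.
by congr (fpsX ^+ _ * fpsC (x ^+ _)); apply: eq_bigr => r _;
  rewrite runner_of_runners.
Qed.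

End FunctionalEquation.

(** * Partitions, cores and the D'Arcais polynomials *)


Lemma hook_gf_coef0 (R : comNzRingType) (x : R) l : fpscoef (hook_gf x l) 0 = 1.
Proof.
rewrite /= fpscoef_word_gf (big_pred1 [tuple]) => [|t]; last first.
  by rewrite tuple0 /word_inv big_geq //= !eqxx.
by rewrite /word_inv big_geq.
Qed.

Lemma fps_subst0 (R : comNzRingType) v (f : fps R) : (0 < v)%N ->
  fps_subst 0 v f = fpsC (fpscoef f 0).
Proof.
move=> v0; apply/fpsP => n; rewrite fpscoef_subst /=.
case: ifPn => [/dvdnP[[|k] ->]|]; rewrite ?div0n ?mul0n ?mul1r //.
  by rewrite mulnK // expr0n mul0r muln_eq0 (gtn_eqF v0).
by case: n => //; rewrite dvdn0.
Qed.

(** Runners of length 6 D with 3 D beads on average: for a core of size at most D, each has between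
    D and 5 D beads, so at least D beads and D holes, and its series agrees with [hook_gf] up to
    q^D. *)
Lemma hook_gf_eqmod (R : comNzRingType) (x : R) l D : prime l ->
  eqmodX D (hook_gf x l)
    ((\sum_(nu : {ffun 'I_l -> 'I_(6 * D).+1} | (\sum_r nu r == l * (3 * D))%N)
        fpsX ^+ core_size (fun r : 'I_l => nu r : nat)) *
     fps_subst x l (hook_gf x l) ^+ l).
Proof.
move=> l_prime; have l_gt0 := prime_gt0 l_prime.
apply: (@eqmodX_trans _ _ (word_gf x l (6 * D * l) (l * (3 * D)))).
  by apply: eqmodX_sym; apply: word_gf_hook_gf; nia.
rewrite word_gf_runners // mulr_suml; apply: eqmodX_sum => nu /eqP nu_h.
apply: eqmodXXnM => core_D; rewrite -[l in _ ^+ l]card_ord -prodr_const.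
apply: eqmodX_prod => r _; apply: eqmodX_subst; apply: word_gf_hook_gf.
  have [_] := core_size_range l_gt0 r nu_h; move: core_D;
    move: (core_size _) => c; lia.
have [+ _] := core_size_range l_gt0 r nu_h; move: core_D;
  move: (core_size _) => c; lia.
Qed.

(** The sum over [nu] in [hook_gf_eqmod] does not involve x. At x = 0 the substituted factor is 1,
    so this sum is [hook_gf 0 l] up to q^D. *)
Lemma hook_gf_fun_eq (R : comNzRingType) (x : R) l : prime l ->
  hook_gf x l = hook_gf 0 l * fps_subst x l (hook_gf x l) ^+ l.
Proof.
move=> l_prime; have l_gt0 := prime_gt0 l_prime.
apply: eqmodX_eq => D; have := hook_gf_eqmod x (D := D) l_prime.
move/eqmodX_trans; apply.
apply: eqmodXM => //; apply: eqmodX_sym.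
have := hook_gf_eqmod (0 : R) (D := D) l_prime.
by rewrite fps_subst0 // hook_gf_coef0 rmorph1 expr1n mulr1.
Qed.

Lemma hook_gf0E l : hook_gf (0 : rat) l = P_hook l 0.
Proof.
have phi0 : horner_eval (0 : rat) 'X = 0 by rewrite /horner_eval hornerX.
rewrite -[in hook_gf _]phi0 -map_hook_gf; apply/fpsP => n.
by rewrite [RHS]/= -(coef_hook_gfX rat) -horner_coef0.
Qed.

(** * Gaussian binomials and the Euler product *)

Section Gauss.
Variables (R : comNzRingType) (l : nat).

Local Notation gauss := (word_gf (1 : R) l).

Definition qpoch n : fps R := \prod_(1 <= i < n.+1) (1 - fpsX ^+ i).

Lemma qpoch0 : qpoch 0 = 1.
Proof. by rewrite /qpoch big_geq. Qed.

Lemma qpochS n : qpoch n.+1 = qpoch n * (1 - fpsX ^+ n.+1).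
Proof. by rewrite /qpoch big_nat_recr. Qed.

Lemma gaussE m N : gauss m N =
  \sum_(t : m.-tuple bool | count id t == N) fpsX ^+ word_inv (fun=> 1%N) t.
Proof. by apply: eq_bigr => t _; rewrite expr1n rmorph1 mulr1. Qed.

(** The q-Pascal rule, by the first letter: a leading bead forms an inversion with each of the
    [m - N'] holes. *)
Lemma gauss_cons m N : gauss m.+1 N =
  (if N is N'.+1 then fpsX ^+ (m - N') * gauss m N' else 0) + gauss m N.
Proof.
rewrite !gaussE.
pose c (p : bool * m.-tuple bool) : m.+1.-tuple bool := [tuple of p.1 :: p.2].
rewrite (reindex c) /=; last first.
  exists (fun t => (thead t, [tuple of behead t])) => [[b t] _|t _] /=.
    by congr (_, _); apply/val_inj.
  by rewrite /c /= -tuple_eta.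
rewrite -(pair_big_dep xpredT (fun (b : bool) (t : m.-tuple bool) => b + count
  id t == N)%N
  (fun (b : bool) (t : m.-tuple bool) => fpsX ^+ word_inv (fun=> 1%N) (b ::
    t))) /=.
rewrite big_bool /=; congr (_ + _); last first.
  by apply: eq_bigr => t _; rewrite word_inv_cons.
case: N => [|N]; first by rewrite big_pred0.
rewrite gaussE big_distrr; apply: eq_big => [t|t /eqP [<-]] //.
rewrite word_inv_cons exprD size_tuple; congr (fpsX ^+ _ * _).
have -> : (m - (0 + count id t) = count (predC id) t)%N.
  by have := count_predC id t; rewrite size_tuple; lia.
rewrite -sum1_count (big_nth false) size_tuple [RHS]big_mkcond.
by apply: eq_bigr => i _ /=; case: nth.
Qed.

Lemma gauss_small m N : (m < N)%N -> gauss m N = 0.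
Proof.
move=> mN; rewrite gaussE big_pred0 // => t; apply/negbTE.
by rewrite neq_ltn (leq_ltn_trans (count_size _ _)) ?size_tuple.
Qed.

Lemma gauss0 m : gauss m 0 = 1.
Proof.
elim: m => [|m IHm]; last by rewrite gauss_cons add0r.
rewrite gaussE (big_pred1 [tuple]) => [|t]; last by rewrite tuple0.
by rewrite /word_inv big_geq.
Qed.

(** Induction along the q-Pascal rule, using q^(m-N) (1 - q^(N+1)) + (1 - q^(m-N)) = 1 - q^(m+1). *)
Lemma gauss_qpoch m N : (N <= m)%N ->
  gauss m N * qpoch N * qpoch (m - N) = qpoch m.
Proof.
elim: m N => [|m IHm] [|N] // N_m.
- by rewrite gauss0 qpoch0 !mul1r.
- by rewrite gauss0 qpoch0 !mul1r.
rewrite gauss_cons subSS qpochS !mulrDl.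
have -> : fpsX ^+ (m - N) * gauss m N * (qpoch N * (1 - fpsX ^+ N.+1)) * qpoch
  (m - N)
  = fpsX ^+ (m - N) * (1 - fpsX ^+ N.+1) * qpoch m by rewrite -(IHm N) //; ring.
have -> : gauss m N.+1 * (qpoch N * (1 - fpsX ^+ N.+1)) * qpoch (m - N) =
   (1 - fpsX ^+ (m - N)) * qpoch m.
  move: N_m; rewrite ltnS leq_eqVlt => /predU1P[->|N_m].
    (* For N = m both sides vanish: there are too few letters on the left, and 1 - q^0 = 0 on the
       right. *)
    by rewrite gauss_small // subnn expr0 subrr !mul0r.
  by rewrite -(IHm N.+1) // -(subnSK N_m) !qpochS; ring.
rewrite qpochS mulrBr mulr1 -exprD addnS subnK //.
ring.
Qed.

Lemma one_sub_Xn_low m n : (0 < m)%N -> (n < m)%N ->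
  fpscoef (1 - fpsX ^+ m : fps R) n = (n == 0%N)%:R.
Proof.
by move=> _ nm; rewrite fpscoefD fpscoefN fpscoef1 fpscoefXn (ltn_eqF nm) subr0.
Qed.

Definition euler : fps R := fps_infprod (fun m => 1 - fpsX ^+ m).

Lemma qpoch_euler D n : (D <= n)%N -> eqmodX D (qpoch n) euler.
Proof.
by move=> Dn k kD; apply: (fpscoef_infprod one_sub_Xn_low) (leq_trans kD Dn).
Qed.

(** Limit of [gauss_qpoch] along words with D beads and D holes. The common factor is cancelled in
    [hook_gf1_euler], once [euler] has an inverse. *)
Lemma hook_gf1_euler2 : hook_gf (1 : R) l * euler * euler = euler.
Proof.
apply: eqmodX_eq => D.
apply: (@eqmodX_trans _ _ (gauss (D + D) D * qpoch D * qpoch (D + D - D))).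
  apply: eqmodX_sym; apply: eqmodXM; last by apply: qpoch_euler; rewrite addnK.
  by apply: eqmodXM; [apply: word_gf_hook_gf | apply: qpoch_euler].
by rewrite gauss_qpoch ?leq_addr //; apply: qpoch_euler; apply: leq_addr.
Qed.

End Gauss.

Lemma fps_infprodM (R : comNzRingType) (F G : nat -> fps R) :
  (forall m n, (0 < m)%N -> (n < m)%N -> fpscoef (F m) n = (n == 0%N)%:R) ->
  (forall m n, (0 < m)%N -> (n < m)%N -> fpscoef (G m) n = (n == 0%N)%:R) ->
  fps_infprod (fun m => F m * G m) = fps_infprod F * fps_infprod G.
Proof.
move=> F1 G1; apply: eqmodX_eq => D n nD.
have -> : fpscoef (fps_infprod (fun m => F m * G m)) n =
    fpscoef (\prod_(1 <= m < n.+1) F m * \prod_(1 <= m < n.+1) G m) n.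
  by rewrite -big_split.
apply: (eqmodXM (D := n)) => // k kn; exact: fpscoef_infprod.
Qed.

(** * D'Arcais series at integer exponents *)

Section DArcaisTheory.
Variable K : numFieldType.

Lemma gbinom0 (r : K) : gbinom r 0 = 1.
Proof. by rewrite /gbinom big_ord0 divr1. Qed.

Lemma gbinomS (r : K) j : gbinom (r + 1) j.+1 = gbinom r j.+1 + gbinom r j.
Proof.
rewrite /gbinom big_ord_recl subr0.
have -> : \prod_(i < j) (r + 1 - (bump 0 i)%:R) = \prod_(i < j) (r - i%:R).
  apply: eq_bigr => i _; rewrite /bump leq0n add1n -natr1; ring.
rewrite big_ord_recr /= factS natrM.
have j0 : j.+1%:R != 0 :> K by rewrite pnatr_eq0.
have f0 : j`!%:R != 0 :> K by rewrite pnatr_eq0 -lt0n fact_gt0.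
rewrite -natr1 in j0 *; field.
by rewrite j0 f0.
Qed.

(** Pascal's rule [gbinomS], read in the coefficients. Steps by one in the exponent reach every
    integer from 0. *)
Lemma one_sub_qpowD1 m (r : K) : (0 < m)%N ->
  one_sub_qpow m (r + 1) = one_sub_qpow m r * (1 - fpsX ^+ m).
Proof.
move=> m0; apply/fpsP => n; rewrite mulrBr mulr1 mulrC fpscoefD fpscoefN
  fpscoefXnM /=.
case: (leqP m n) => mn; last first.
  case: n mn => [|n] mn; first by rewrite dvdn0 div0n !gbinom0 subr0.
  by rewrite gtnNdvd // subr0.
rewrite dvdn_subl //; case: ifP => [/dvdnP[[|k] def_n]|]; last by rewrite subr0.
  by rewrite def_n leqNgt m0 in mn.
have -> : (n - m = k * m)%N by rewrite def_n mulSn addKn.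
rewrite def_n !mulnK // gbinomS exprS; ring.
Qed.

Definition darcais_gf (r : K) : fps K := fps_infprod (fun m => one_sub_qpow m
  r).

Lemma darcais_gfD1 r : darcais_gf (r + 1) = darcais_gf r * euler K.
Proof.
rewrite -fps_infprodM; last exact: one_sub_Xn_low; last exact: one_sub_qpow_low.
apply/fpsP => n /=; congr (fpscoef _ n).
by apply: eq_big_nat => m /andP[m0 _]; rewrite one_sub_qpowD1.
Qed.

Lemma darcais_gf0 : darcais_gf 0 = 1.
Proof.
apply/fpsP => n /=; rewrite big_nat big1 // => m /andP[m0 _].
apply/fpsP => k /=; case: (posnP k) => [->|k0].
  by rewrite dvdn0 div0n gbinom0 mulr1.
case: ifP => // mk.
rewrite /gbinom; case def_j: (k %/ m)%N => [|j].
  by move: mk k0 => /dvdnP[i def_k]; move: def_j; rewrite def_k mulnK // => ->.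
by rewrite big_ord_recl subrr !mul0r mulr0.
Qed.

Lemma darcais_gf_nat n : darcais_gf n%:R = euler K ^+ n.
Proof.
elim: n => [|n IHn]; first exact: darcais_gf0.
by rewrite -natr1 darcais_gfD1 IHn exprSr.
Qed.

Lemma darcais_gf_opp_nat n : darcais_gf (- n%:R) * euler K ^+ n = 1.
Proof.
elim: n => [|n IHn]; first by rewrite oppr0 darcais_gf0 mulr1.
by rewrite exprS mulrA -darcais_gfD1 -natr1 opprD addrNK.
Qed.

Lemma hook_gf1_euler l : hook_gf (1 : K) l * euler K = 1.
Proof.
have := darcais_gf_opp_nat 1; rewrite expr1 mulrC => inv_e.
by rewrite -[LHS]mulr1 -{1}inv_e mulrA hook_gf1_euler2.
Qed.

Lemma darcais_gf_opp l n : darcais_gf (- n%:R) = hook_gf 1 l ^+ n.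
Proof.
by rewrite -[RHS]mul1r -(darcais_gf_opp_nat n) -mulrA -exprMn [euler K * _]mulrC
  hook_gf1_euler expr1n mulr1.
Qed.

End DArcaisTheory.

Lemma sum_dvdn_div (R : comNzRingType) v n (G : nat -> R) : (0 < v)%N ->
  \sum_(i < n.+1 | (v %| i)%N) G i = \sum_(j < (n %/ v).+1) G (j * v)%N.
Proof.
move=> v0; rewrite -sum_dvdn //.
rewrite -!(big_mkord (fun i => v %| i)%N G).
rewrite (@big_cat_nat _ _ _ (n %/ v * v).+1) //=;
  last by rewrite ltnS leq_trunc_div.
rewrite [X in _ + X]big_nat_cond [X in _ + X]big1 ?addr0 // => i /andP[/andP[lo
  hi] vi].
move: lo hi; case/dvdnP: vi => k ->; rewrite ltn_pmul2r // ltnS => lt_k.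
by rewrite leqNgt -ltn_divLR // lt_k.
Qed.

(** At x = 1 the functional equation, multiplied by the Euler product at q^l to the power l, gives
    C(q) as that power times P(q). Its power l^k is the D'Arcais series of l^(k+1) at q^l times that
    of -l^k. *)
Lemma core_pow_coef l k z : prime l ->
  fpscoef (P_hook l 0 ^+ (l ^ k)%N) z =
  \sum_(0 <= m < (z %/ l).+1)
     darcais ((l ^ k.+1)%:R : rat) m * darcais (- (l ^ k)%:R : rat) (z - m *
       l)%N.
Proof.
move=> l_prime; have l_gt0 := prime_gt0 l_prime.
have euler_inv := hook_gf1_euler rat l.
have C_eq : P_hook l 0 = fps_subst 1 l (euler rat) ^+ l * hook_gf 1 l.
  rewrite [in RHS](hook_gf_fun_eq 1 l_prime) hook_gf0E mulrCA -exprMn.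
  by rewrite -fps_substM // mulrC [euler _ * _]mulrC euler_inv fps_subst1 //
    expr1n mul1r.
rewrite C_eq exprMn -exprM -fps_substX // -darcais_gf_nat -expnS
  -darcais_gf_opp.
rewrite fpscoefM big_mkord.
rewrite (bigID (fun i : 'I__ => l %| i)%N) /= [X in _ + X]big1 => [|i];
  last first.
  by move=> /negPf ->; rewrite mul0r.
pose T i := fpscoef (fps_subst 1 l (darcais_gf (l ^ k.+1)%:R)) i *
  fpscoef (darcais_gf (- (l ^ k)%:R : rat)) (z - i).
rewrite addr0 (sum_dvdn_div z T l_gt0).
by apply: eq_bigr => i _; rewrite /T /= dvdn_mull // mulnK // expr1n mul1r.
Qed.

(** * Iteration of the functional equation *)


Lemma qbracket_sum l k : prime l -> qbracket l k = (\sum_(i < k) l ^ i)%N.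
Proof.
move=> /prime_gt1 l_gt1; rewrite /qbracket !subn1 predn_exp mulKn //; lia.
Qed.

Lemma qbracketS l k : prime l -> qbracket l k.+1 = (l * qbracket l k + 1)%N.
Proof.
move=> l_prime; rewrite !qbracket_sum // big_ord_recl expn0 addnC.
by rewrite big_distrr; congr addn; apply: eq_bigr => i _; rewrite lift0 expnS.
Qed.

Lemma qbracket_ge l k : prime l -> (k <= qbracket l k)%N.
Proof.
move=> l_prime; elim: k => // k IHk; rewrite qbracketS //.
have := prime_gt0 l_prime; nia.
Qed.

Section Iteration.
Variable l : nat.
Hypothesis l_prime : prime l.
Let l_gt0 : (0 < l)%N := prime_gt0 l_prime.
Let lX_gt0 k : (0 < l ^ k)%N. Proof. by rewrite expn_gt0 l_gt0. Qed.

Local Notation F := (hook_gf ('X : {poly rat}) l).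
Local Notation S k := (fps_subst ('X ^+ qbracket l k : {poly rat}) (l ^ k)).
Local Notation iota := (fps_map (polyC : {rmorphism rat -> {poly rat}})).

Lemma hook_gf_polyC : hook_gf (0 : {poly rat}) l = iota (P_hook l 0).
Proof. by rewrite -hook_gf0E map_hook_gf rmorph0. Qed.

(** The functional equation is applied inside the last factor; by [fps_subst_comp] and [qbracketS]
    the two substitutions compose to the next one. *)
Lemma hook_gf_iter K : F =
  (\prod_(0 <= k < K) S k (iota (P_hook l 0 ^+ (l ^ k)%N))) * S K F ^+ (l ^
    K)%N.
Proof.
elim: K => [|K {1}->].
  rewrite big_geq // mul1r qbracket_sum // big_ord0 !expr0 expn0 expr1.
  by rewrite fps_subst1n.
rewrite big_nat_recr //= -mulrA; congr (_ * _).
rewrite {1}(hook_gf_fun_eq 'X l_prime) hook_gf_polyC fps_substM // exprMn.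
rewrite fps_mapX fps_substX // fps_substX // -exprM -expnS; congr (_ * _ ^+ _).
rewrite fps_subst_comp // qbracketS // -expnSr -exprM -exprS addn1.
by rewrite [(qbracket l K * l)%N]mulnC.
Qed.

(** The first possible nonconstant term has degree l^K, which exceeds K. *)
Lemma subst_hook_gf_eqmod D K : (D < K)%N -> eqmodX D (S K F) 1.
Proof.
move=> DK n nD; rewrite fpscoef_subst fpscoef1; case: ifPn => [|].
  case: n nD => [|n] nD; first by rewrite div0n hook_gf_coef0 mulr1.
  move=> /dvdn_leq -/(_ isT); have := ltn_expl K (prime_gt1 l_prime); lia.
by case: n nD => //; rewrite dvdn0.
Qed.

Lemma eqmodX_expand (R : comNzRingType) D Z (f : fps R) : (D < Z)%N ->
  eqmodX D f (\sum_(z < Z) fpsX ^+ z * fpsC (fpscoef f z)).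
Proof.
move=> DZ n nD; rewrite fpscoef_sum.
have nZ := leq_ltn_trans nD DZ.
rewrite (bigD1 (Ordinal nZ)) // big1 => [|z z_n].
  by rewrite [RHS]addr0 fpscoef_monom eqxx.
rewrite fpscoef_monom (_ : (n == z) = false) //.
by apply: contraNF z_n => /eqP n_z; apply/eqP/val_inj.
Qed.

Definition coefX_gf (R : comNzRingType) (a : nat) (f : fps {poly R}) : fps R :=
  FPS (fun n => (fpscoef f n)`_a).

Lemma coefX_gfE (R : comNzRingType) a (f : fps {poly R}) n :
  fpscoef (coefX_gf a f) n = (fpscoef f n)`_a.
Proof. by []. Qed.

Lemma coefX_gf_hook a : coefX_gf a F = P_hook l a.
Proof. by apply/fpsP => n; apply: (coef_hook_gfX rat). Qed.

Lemma coefX_gf_mulC a (f : fps rat) (g : fps {poly rat}) :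
  coefX_gf a (iota f * g) = f * coefX_gf a g.
Proof.
apply/fpsP => n; rewrite /= coef_sum; apply: eq_bigr => i _.
by rewrite coefCM.
Qed.

Lemma coefX_gf_sum a (I : finType) (G : I -> fps {poly rat}) :
  coefX_gf a (\sum_i G i) = \sum_i coefX_gf a (G i).
Proof.
by apply/fpsP => n; rewrite /= !fpscoef_sum coef_sum.
Qed.

Lemma coefX_gf_monom a n b (c : rat) :
  coefX_gf a (fpsX ^+ n * fpsC ('X ^+ b * c%:P)) =
  if b == a then fpsX ^+ n * fpsC c else 0.
Proof.
apply/fpsP => i; rewrite coefX_gfE fpscoef_monom.
case: (b =P a) => [->|/eqP b_a].
  by rewrite fpscoef_monom; case: eqP; rewrite ?coef0 // coefMC coefXn eqxx
    mul1r.
by case: eqP; rewrite ?coef0 // coefMC coefXn eq_sym (negPf b_a) mul0r.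
Qed.

(* The factor of index [k] in the definition of [Omega]. *)
Definition Omega_factor k z : fps rat :=
  fpsX ^+ (z * l ^ k)%N * fpsC (fpscoef (P_hook l 0 ^+ (l ^ k)%N) z).

Lemma P_hook00 : fpscoef (P_hook l 0) 0 = 1.
Proof. by rewrite -hook_gf0E hook_gf_coef0. Qed.

Lemma Omega_factor0 k : Omega_factor k 0 = 1.
Proof.
rewrite /Omega_factor mul0n expr0 mul1r.
suff -> : fpscoef (P_hook l 0 ^+ (l ^ k)) 0 = 1 by rewrite rmorph1.
elim: (l ^ k)%N => // j IHj.
by rewrite exprS fpscoefM big_ord1 subnn P_hook00 IHj mulr1.
Qed.

(** A finite box of sequences: index [k] holds the entry z_(k+1), hence the bracket of [k.+1]. *)
Definition Zbounded a K Z (z : {ffun 'I_K -> 'I_Z}) : bool :=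
  (\sum_(k < K) z k * qbracket l k.+1 == a)%N.

Lemma P_hook_eqmod a D K Z : (D <= K)%N -> (D < Z)%N ->
  eqmodX D (P_hook l a)
    (P_hook l 0 * \sum_(z : {ffun 'I_K -> 'I_Z} | Zbounded a z)
       \prod_(k < K) Omega_factor k.+1 (z k)).
Proof.
move=> DK DZ.
pose T (k : 'I_K) (z : 'I_Z) : fps {poly rat} :=
  fpsX ^+ (l ^ k.+1 * z) *
  fpsC ('X ^+ (qbracket l k.+1 * z) *
        (fpscoef (P_hook l 0 ^+ (l ^ k.+1)%N) z)%:P).
pose G := \sum_(z : {ffun 'I_K -> 'I_Z}) \prod_(k < K) T k (z k).
have F_eq : eqmodX D F (iota (P_hook l 0) * G).
  (* K + 1 steps give the factors 0 to K, and the remaining one is 1 up to q^D. *)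
  rewrite (hook_gf_iter K.+1) -[X in eqmodX _ _ X]mulr1.
  apply: eqmodXM; last first.
    by rewrite -(expr1n _ (l ^ K.+1)); apply: eqmodXX;
      apply: subst_hook_gf_eqmod.
  (* Factor 0 is C(q) itself and stays outside; the others are expanded in monomials and multiplied
     out into a sum over [z]. *)
  rewrite big_nat_recl // qbracket_sum // big_ord0 !expn0 !expr0 expr1
    fps_subst1n.
  apply: eqmodXM => //; rewrite big_mkord /G -(bigA_distr_bigA T).
  apply: eqmodX_prod => k _.
  apply: eqmodX_trans (eqmodX_subst _ _ (eqmodX_expand _ DZ)) _.
  rewrite fps_subst_sum; apply: eqmodX_sum => z _.
  by rewrite fps_subst_monom // -exprM /T.
(* C(q) is free of x, so taking the coefficient of x^a acts on [G] alone, where it selects the [z]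
   of weight [a]. *)
suff -> : \sum_(z : {ffun 'I_K -> 'I_Z} | Zbounded a z)
    \prod_(k < K) Omega_factor k.+1 (z k) = coefX_gf a G.
  by rewrite -coefX_gf_mulC -coefX_gf_hook => n nD; rewrite !coefX_gfE F_eq.
rewrite coefX_gf_sum big_mkcond; apply: eq_bigr => z _.
have -> : \prod_(k < K) T k (z k) =
    fpsX ^+ (\sum_(k < K) z k * l ^ k.+1) *
    fpsC ('X ^+ (\sum_(k < K) z k * qbracket l k.+1) *
          (\prod_(k < K) fpscoef (P_hook l 0 ^+ (l ^ k.+1)%N) (z k))%:P).
  rewrite !rmorphM !rmorph_prod -!prodrXr rmorph_prod -!big_split /=.
  by apply: eq_bigr => k _; rewrite /T rmorphM [(_ * z k)%N]mulnC
    [(qbracket _ _ * _)%N]mulnC.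
rewrite coefX_gf_monom /Zbounded; case: eqP => // _.
by rewrite rmorph_prod -prodrXr -big_split.
Qed.

End Iteration.

(** * From finitely supported sequences to finite boxes *)

Lemma fsbig_ge1 (R : Type) (idx : R) (op : Monoid.com_law idx)
    (f : nat -> R) K :
  (forall k, (K < k)%N -> f k = idx) ->
  \big[op/idx]_(k \in [set k | (1 <= k)%N]%classic) f k =
  \big[op/idx]_(k < K) f k.+1.
Proof.
move=> f_idx; rewrite -(big_mkord xpredT (fun k => f k.+1)).
rewrite -(big_add1 _ _ 0 K.+1 xpredT f).
transitivity (\big[op/idx]_(k <- index_iota 1 K.+1 | (1 <= k)%N) f k).
  rewrite [RHS]bigfs ?iota_uniq // => k k_gt0;
    rewrite mem_index_iota k_gt0 /= -leqNgt.
  exact: f_idx.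
by rewrite [RHS]big_nat [LHS]big_nat_cond; apply: eq_bigl => k;
  case: (1 <= k)%N; rewrite ?andbT.
Qed.

Section OmegaReindex.
Variables (l a : nat).
Hypothesis l_prime : prime l.

Definition Zextend K Z (z : {ffun 'I_K -> 'I_Z}) (k : nat) : nat :=
  if k is k'.+1 then oapp (fun i : 'I_K => z i : nat) 0%N (insub k') else 0%N.

Lemma ZextendS K Z (z : {ffun 'I_K -> 'I_Z}) (k : 'I_K) : Zextend z k.+1 = z k.
Proof. by rewrite /Zextend /= valK. Qed.

Lemma Zextend_out K Z (z : {ffun 'I_K -> 'I_Z}) k :
  (K < k)%N -> Zextend z k = 0%N.
Proof. by case: k => // k Kk; rewrite /Zextend insubF // ltnNge -ltnS Kk. Qed.

Lemma Zset_le z k : Zset l a z -> (0 < k)%N -> (z k * qbracket l k <= a)%N.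
Proof.
move=> [z0 z_fin <-] k_gt0; case: (posnP (z k)) => [->|zk];
  first by rewrite mul0n.
(* The index set is infinite; it is cut down to the support so that one term can be split off. *)
pose P := ([set k | (1 <= k)%N] `&` [set k | z k <> 0%N])%classic.
rewrite -(fsbig_widen P [set k | (1 <= k)%N]%classic
  (fun k => z k * qbracket l k)%N) => [|? []|j] //; last first.
  by move=> [j_gt0] /not_andP[] //=; rewrite notK => ->; exact: mul0n.
rewrite (fsbigD1 k) ?leq_addr //; last by split=> //=; apply/eqP; rewrite -lt0n.
by apply: sub_finite_set z_fin => ? [].
Qed.

(** If z_k is nonzero, then z_k [k] <= a and k <= [k] give k <= a and z_k <= a, so every sequence of
    weight [a] fits in the box. *)
Lemma Zextend_bij K Z : (a <= K)%N -> (a < Z)%N ->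
  set_bij [set z : {ffun 'I_K -> 'I_Z} | Zbounded l a z]%classic (Zset l a)
    (@Zextend K Z).
Proof.
move=> aK aZ; split.
- move=> z /eqP z_a; split=> //.
    apply: (@sub_finite_set _ _ `I_K.+1); last exact: finite_II.
    by move=> k /= zk; rewrite ltnNge; apply/negP => Kk; apply: zk;
      apply: Zextend_out.
  rewrite (@fsbig_ge1 _ _ _ _ K) => [|k Kk]; last by rewrite Zextend_out.
  by rewrite -[RHS]z_a; apply: eq_bigr => k _; rewrite ZextendS.
- move=> z1 z2 _ _ z12; apply/ffunP => k; apply/val_inj.
  by rewrite /= -!ZextendS z12.
move=> z zZ; have [z0 _ _] := zZ.
have z_le k : (z k.+1 < Z)%N.
  have := Zset_le zZ (ltn0Sn k); have := qbracket_ge k.+1 l_prime; nia.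
have z_out k : (K < k)%N -> z k = 0%N.
  move=> Kk; have := Zset_le zZ (leq_ltn_trans (leq0n K) Kk).
  by have := qbracket_ge k l_prime; nia.
pose y : {ffun 'I_K -> 'I_Z} := [ffun k : 'I_K => Ordinal (z_le k)].
have yE : Zextend y = z.
  apply/funext => -[|k]; first by rewrite z0.
  have [kK|Kk] := ltnP k K; last by rewrite Zextend_out ?z_out.
  by rewrite (ZextendS y (Ordinal kK)) ffunE.
exists y => //; have [_ _] := zZ; rewrite -yE.
rewrite (@fsbig_ge1 _ _ _ _ K) => [y_a|k Kk]; last by rewrite Zextend_out.
by apply/eqP; rewrite -[RHS]y_a; apply: eq_bigr => k _; rewrite ZextendS.
Qed.

Lemma Omega_Zbounded K Z : (a <= K)%N -> (a < Z)%N ->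
  Omega l a = \sum_(z : {ffun 'I_K -> 'I_Z} | Zbounded l a z)
    \prod_(k < K) Omega_factor l k.+1 (z k).
Proof.
move=> aK aZ; rewrite /Omega (reindex_fsbig _ _ _ _ (Zextend_bij aK aZ)).
rewrite [RHS]bigfs ?index_enum_uniq //;
  last by move=> z _; rewrite mem_index_enum.
apply: eq_fsbigr => z _; rewrite (@fsbig_ge1 _ _ _ _ K) => [|k Kk].
  apply: eq_bigr => k _; rewrite ZextendS /Omega_factor.
  by rewrite core_pow_coef.
rewrite Zextend_out // -(Omega_factor0 l k) /Omega_factor.
by rewrite core_pow_coef.
Qed.

End OmegaReindex.

Theorem theorem1p1 (l a : nat) (l_prime : prime l) :
  P_hook l a = Omega l a * P_hook l 0.
Proof.
apply: eqmodX_eq => D.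
(* K = D + a and Z = D + a + 1 are large enough both for the weight [a] and for the precision
   [D]. *)
have aK : (a <= D + a)%N := leq_addl D a.
rewrite mulrC (Omega_Zbounded l_prime aK (aK : a < (D + a).+1)%N).
by apply: P_hook_eqmod; rewrite // ?ltnS leq_addr.
Qed.
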